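(* For $n,k\ge0$ let $r_{n,k}$ be the number of run-sorted permutations of $[n]$ having exactly $k$ runs (with $r_{0,0}=1$, $r_{1,0}=0$, $r_{1,1}=1$). Then for all $n\ge2$ and $k\ge1$, $$r_{n,k}=k\,r_{n-1,k}+(n-2)\,r_{n-2,k-1}.$$
   Context: A run of a permutation $\pi=\pi_1\cdots\pi_n$ (one-line notation) is a maximal increasing factor of consecutive letters. A permutation of $[n]$ is run-sorted if it is obtained by concatenating the blocks of a set partition $B_1/\cdots/B_k$ of $[n]$ written in block representation (elements of each block in increasing order, blocks ordered so that $\min B_1<\cdots<\min B_k$); equivalently, the minima of its successive runs are increasing. The empty permutation has $0$ runs. *)

(* Defs.v *)
From mathcomp Require Import all_boot all_fingroup.

Set Implicit Arguments.
Unset Strict Implicit.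
Unset Printing Implicit Defensive.

(* Permutations of [n] are elements of 'S_n; both positions and letters are
   numbered 0, ..., n-1. *)

Section RunSorted.

Variable n : nat.
Implicit Types (p : 'S_n) (i j : 'I_n) (B : {set 'I_n}) (P : {set {set 'I_n}}).

Definition one_line p : seq 'I_n := [seq p i | i <- enum 'I_n].

(* A nonempty factor of p is given by the positions i <= j of its first and
   last letters. *)
Definition increasing_factor p i j : bool :=
  (i <= j) &&
  [forall a : 'I_n, forall b : 'I_n,
     [&& i <= a, a < b & b <= j] ==> (p a < p b)].

Definition is_run p i j : bool :=
  increasing_factor p i j &&
  [forall i' : 'I_n, forall j' : 'I_n,
     [&& i' <= i, j <= j' & increasing_factor p i' j']
       ==> (i' == i) && (j' == j)].

Definition num_runs p : nat := #|[set ij : 'I_n * 'I_n | is_run p ij.1 ij.2]|.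

(* n exceeds every element of 'I_n, so it is neutral for minn. *)
Definition block_min B : nat := \big[minn/n]_(x in B) x.

Definition sorted_blocks P : seq {set 'I_n} :=
  sort (fun B C => block_min B <= block_min C) (enum P).

(* enum B lists the elements of B : {set 'I_n} in increasing order. *)
Definition block_representation P : seq (seq 'I_n) :=
  [seq enum B | B : {set 'I_n} <- sorted_blocks P].

Definition run_sorted p : bool :=
  [exists P : {set {set 'I_n}},
     partition P [set: 'I_n] && (one_line p == flatten (block_representation P))].

End RunSorted.

Definition r (n k : nat) : nat :=
  #|[set p : 'S_n | run_sorted p & num_runs p == k]|.

(* Main.v *)
Require Import Defs.
From HB Require Import structures.
From mathcomp Require Import all_boot all_fingroup.
From mathcomp Require Import zify.

Set Implicit Arguments.
Unset Strict Implicit.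
Unset Printing Implicit Defensive.

(* Represent a set partition of {0, ..., n-1} by the list of its blocks and call
   two consecutive blocks B, C mergeable if max B < min C. The run-sorted
   permutations with k runs are the concatenations of the partitions with k
   blocks and no mergeable pair. Let A(n, k, t) count the partitions with k
   blocks and t mergeable pairs. The new maximum n either joins the first block
   of a mergeable pair (t choices, one pair is lost), joins another block
   (k - t choices, t is unchanged) or forms a new last block (one pair is
   gained), so for n >= 1
     A(n+1, k, t) = (t+1) A(n, k, t+1) + (k-t) A(n, k, t) + A(n, k-1, t-1).
   By induction A(n+1, k+t, t) = 'C(n, t) A(n+1-t, k, 0), and the theorem is the
   recurrence at t = 0 with A(n-1, k, 1) = (n-2) A(n-2, k-1, 0). *)

(** * Set partitions generated by inserting the maximum *)

Notation heads bs := (map (head 0) bs).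

(** The letter [n] is meant to exceed all letters of [bs]: appended to a block it keeps the block
    increasing, and as a singleton it has the largest minimum and goes last. *)
Fixpoint insertions (n : nat) (bs : seq (seq nat)) : seq (seq (seq nat)) :=
  if bs is B :: bs' then
    (rcons B n :: bs') :: [seq B :: cs | cs <- insertions n bs']
  else [:: [:: [:: n]]].

Fixpoint block_lists (n : nat) : seq (seq (seq nat)) :=
  if n is m.+1 then flatten [seq insertions m bs | bs <- block_lists m]
  else [:: [::]].

(** On increasing nonempty blocks, [last] is the maximum and [head] the minimum. The value [false]
    on the empty list says that the last block starts no mergeable pair. *)
Definition fits (B : seq nat) (bs : seq (seq nat)) : bool :=
  if bs is C :: _ then last 0 B < head 0 C else false.

Fixpoint mergeable (bs : seq (seq nat)) : nat :=
  if bs is B :: bs' then fits B bs' + mergeable bs' else 0.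

Definition block_count (n k t : nat) : nat :=
  count (fun bs => (size bs == k) && (mergeable bs == t)) (block_lists n).

Definition increasing_blocks (bs : seq (seq nat)) : bool :=
  all (fun B => (B != [::]) && sorted ltn B) bs.

(** Block representations of the set partitions of the first [n] naturals; the head of an increasing
    block is its minimum. *)
Definition representation (n : nat) (bs : seq (seq nat)) : bool :=
  [&& perm_eq (flatten bs) (iota 0 n),
      increasing_blocks bs & sorted ltn (heads bs)].

Lemma insertions_cat n bs cs :
  [::] \notin bs -> cs \in insertions n bs ->
  (exists bs1 B bs2, bs = bs1 ++ B :: bs2 /\ cs = bs1 ++ rcons B n :: bs2)
  \/ cs = rcons bs [:: n].
Proof.
elim: bs cs => [|B bs IH] cs /=; first by rewrite inE => _ /eqP->; right.
rewrite inE negb_or => /andP[_ Nbs]; rewrite inE => /predU1P[->|].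
  by left; exists [::], B, bs.
case/mapP=> ds /(IH _ Nbs)[[bs1 [C [bs2 [-> ->]]]] ->|-> ->]; last by right.
by left; exists (B :: bs1), C, bs2.
Qed.

Lemma mem_insertions_cat n bs1 B bs2 :
  bs1 ++ rcons B n :: bs2 \in insertions n (bs1 ++ B :: bs2).
Proof.
elim: bs1 => [|C bs1 IH] /=; first by rewrite inE eqxx.
by rewrite inE (map_f (cons C)) ?orbT.
Qed.

Lemma mem_insertions_rcons n bs : rcons bs [:: n] \in insertions n bs.
Proof.
elim: bs => [|C bs IH] /=; first by rewrite inE.
by rewrite inE (map_f (cons C)) ?orbT.
Qed.

Lemma perm_iota_recr s n : perm_eq s (iota 0 n.+1) = perm_eq s (n :: iota 0 n).
Proof. rewrite -addn1 iotaD add0n /= cats1.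
by rewrite perm_sym perm_rcons perm_sym. Qed.

Lemma flatten_insert bs1 B (n : nat) bs2 :
  perm_eq (flatten (bs1 ++ rcons B n :: bs2)) (n :: flatten (bs1 ++ B :: bs2)).
Proof.
apply/seq.permP=> a; rewrite !flatten_cat /= -cats1 !count_cat /= ?count_cat; lia.
Qed.

Lemma sorted_ltn_rcons s n :
  sorted ltn (rcons s n) = sorted ltn s && all (fun x => x < n) s.
Proof.
have tr : transitive ltn by apply: ltn_trans.
rewrite !(sorted_pairwise tr) -cats1 pairwise_cat /= andbT allrel1r andbC.
by congr andb.
Qed.

Lemma head_lt n bs B :
  {in flatten bs, forall x, x < n} -> B \in bs -> B != [::] -> head 0 B < n.
Proof.
move=> lt_n Bbs; case: B Bbs => // x B Bbs _ /=; apply: lt_n.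
by apply/flattenP; exists (x :: B); rewrite ?inE ?eqxx.
Qed.

Lemma representation_lt n bs :
  representation n bs -> {in flatten bs, forall x, x < n}.
Proof. by case/and3P=> /perm_mem e _ _ x; rewrite e mem_iota. Qed.

Lemma representation_insert n bs1 B bs2 : B != [::] ->
  representation n.+1 (bs1 ++ rcons B n :: bs2) =
  representation n (bs1 ++ B :: bs2).
Proof.
move=> B0; rewrite /representation /increasing_blocks perm_iota_recr.
rewrite (permPl (flatten_insert _ _ _ _)) perm_cons.
rewrite !all_cat /= !map_cat /= sorted_ltn_rcons.
have -> : head 0 (rcons B n) = head 0 B by case: B B0.
have -> : rcons B n != [::] by case: (B).
rewrite B0 /=; case: (boolP (perm_eq _ _)) => //= /perm_mem e.
suff -> : all (fun x => x < n) B by rewrite andbT.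
apply/allP=> x xB; have := e x; rewrite mem_iota /= => <-.
by rewrite flatten_cat /= !mem_cat xB orbT.
Qed.

Lemma representation_rcons n bs :
  representation n.+1 (rcons bs [:: n]) = representation n bs.
Proof.
rewrite /representation /increasing_blocks perm_iota_recr flatten_rcons cats1.
rewrite perm_rcons perm_cons.
rewrite all_rcons map_rcons /= sorted_ltn_rcons.
case: (boolP (perm_eq _ _)) => //= /perm_mem e.
case: (boolP (all _ bs)) => //= /allP a.
suff -> : all (fun x => x < n) (heads bs) by rewrite andbT.
apply/allP=> _ /mapP[B Bbs ->]; apply: (head_lt _ Bbs); last by case/andP: (a _ Bbs).
by move=> x; rewrite e mem_iota.
Qed.

Lemma representation_nil_notin n bs : representation n bs -> [::] \notin bs.
Proof. by case/and3P=> _ /allP a _; apply/negP => /a. Qed.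

Lemma insertions_representation n bs cs :
  representation n bs -> cs \in insertions n bs -> representation n.+1 cs.
Proof.
move=> rb; case/(insertions_cat (representation_nil_notin rb)).
  case=> bs1 [B [bs2 [e ->]]]; rewrite representation_insert -?e //.
  apply: contra (representation_nil_notin rb) => /eqP B0.
  by rewrite e B0 mem_cat inE eqxx orbT.
by move=> ->; rewrite representation_rcons.
Qed.

(** The maximum [n] ends its block. If it is alone there, the block is the last one, since the head
    of a later block would exceed [n]. *)
Lemma representation_insertions n cs : representation n.+1 cs ->
  exists2 bs, representation n bs & cs \in insertions n bs.
Proof.
move=> rc; have : n \in flatten cs.
  by case/and3P: rc => /perm_mem -> _ _; rewrite mem_iota /= ltnSn.
case/flattenP=> B Bcs nB; case/splitPr: Bcs rc => cs1 cs2 rc.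
have lt_n := representation_lt rc.
(* An element of [B] after [n] would be larger than [n], yet all letters are at most [n]. *)
have [B' eB] : exists B', B = rcons B' n.
  have sB : sorted ltn B.
    by case/and3P: rc => _; rewrite /increasing_blocks all_cat /= => /and3P[_ /andP[]].
  case/lastP: B nB sB rc lt_n => // B' x nB sB rc lt_n; exists B'.
  congr rcons; move: nB; rewrite mem_rcons inE => /predU1P[//|nB'].
  move: sB; rewrite sorted_ltn_rcons => /andP[_ /allP/(_ _ nB') nx].
  suff : x < n.+1 by rewrite ltnS leqNgt nx.
  by apply: lt_n; rewrite flatten_cat /= !mem_cat mem_rcons inE eqxx orbT.
subst B; case: (eqVneq B' [::]) => [B0|B0]; last first.
  by exists (cs1 ++ B' :: cs2); rewrite ?mem_insertions_cat // -representation_insert.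
subst B'; case: cs2 rc lt_n {nB} => [|C cs2] rc lt_n.
  exists cs1; first by rewrite -representation_rcons -cats1.
  by rewrite cats1 mem_insertions_rcons.
have CC : C \in cs1 ++ [:: n] :: C :: cs2 by rewrite mem_cat !inE eqxx !orbT.
have C0 : C != [::].
  apply: contraNneq (representation_nil_notin rc) => e.
  by rewrite -[X in X \in _]e.
have := head_lt lt_n CC C0.
case/and3P: rc => _ _; rewrite map_cat /= => s.
have := subseq_sorted ltn_trans (suffix_subseq _ _) s => /= /andP[nC _].
by rewrite ltnS leqNgt nC.
Qed.

Lemma mem_block_lists n bs : (bs \in block_lists n) = representation n bs.
Proof.
elim: n bs => [|n IH] bs /=.
  rewrite inE; case: bs => [|B bs] //=.
  apply/esym/negP => /and3P[/perm_size /=]; rewrite size_cat => e.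
  by case/andP=> /andP[]; case: B e.
apply/flattenP/idP => [[s /mapP[cs]]|].
  by rewrite IH => rc -> /(insertions_representation rc).
case/representation_insertions => cs rc bcs.
by exists (insertions n cs) => //; apply: map_f; rewrite IH.
Qed.

(** * Each partition is generated exactly once *)

Definition remove_letter (n : nat) (bs : seq (seq nat)) : seq (seq nat) :=
  [seq B <- [seq [seq x <- B | x != n] | B <- bs] | B != [::]].

Lemma remove_letter_id n bs :
  [::] \notin bs -> {in flatten bs, forall x, x != n} ->
  remove_letter n bs = bs.
Proof.
rewrite /remove_letter; elim: bs => //= B bs IH.
rewrite inE negb_or eq_sym => /andP[B0 N] lt_n.
have -> : [seq x <- B | x != n] = B.
  by apply/all_filterP/allP => x xB; apply: lt_n; rewrite mem_cat xB.
by rewrite B0 IH // => x xb; apply: lt_n; rewrite mem_cat xb orbT.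
Qed.

Lemma insertionsK n bs cs :
  representation n bs -> cs \in insertions n bs -> remove_letter n cs = bs.
Proof.
move=> rb; have N := representation_nil_notin rb.
have nn : {in flatten bs, forall x, x != n}.
  by move=> x /(representation_lt rb); rewrite ltn_neqAle => /andP[].
rewrite -{2}(remove_letter_id N nn).
case/(insertions_cat N) => [[bs1 [B [bs2 [-> ->]]]]|->].
  by rewrite /remove_letter !map_cat /= filter_rcons eqxx.
by rewrite /remove_letter map_rcons filter_rcons /= eqxx.
Qed.

Lemma insertions_uniq n bs :
  {in flatten bs, forall x, x != n} -> uniq (insertions n bs).
Proof.
elim: bs => //= B bs IH lt_n.
rewrite (map_inj_uniq (f := cons B)); last by move=> ? ? [].
rewrite IH => [|x xb]; last by apply: lt_n; rewrite mem_cat xb orbT.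
rewrite andbT; apply/negP => /mapP[cs _ [e _]].
have := lt_n n; rewrite mem_cat -e mem_rcons inE eqxx /=.
by move/(_ isT).
Qed.

(** Insertions into distinct lists are disjoint, because removing the inserted letter recovers the
    original list. *)
Lemma block_lists_uniq n : uniq (block_lists n).
Proof.
elim: n => //= n IH.
have : {in block_lists n, forall bs, representation n bs}.
  by move=> bs; rewrite mem_block_lists.
elim: (block_lists n) IH => //= bs L IHL /andP[bL uL] rL.
rewrite cat_uniq IHL //; last by move=> cs cL; apply: rL; rewrite inE cL orbT.
have rb : representation n bs by apply: rL; rewrite inE eqxx.
rewrite andbT insertions_uniq => [|x /(representation_lt rb)]; last first.
  by rewrite ltn_neqAle => /andP[].
apply/hasPn => cs /flattenP[_ /mapP[ds dL ->] cds]; apply/negP => /= cbs.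
move/negP: bL; apply; rewrite -(insertionsK rb cbs).
by rewrite (insertionsK _ cds) // rL // inE dL orbT.
Qed.

(** * Counting partitions by blocks and mergeable pairs *)

Lemma insertions_fits n B bs cs : bs != [::] -> [::] \notin bs ->
  cs \in insertions n bs -> fits B cs = fits B bs.
Proof.
case: bs => // C bs _; rewrite /= inE negb_or inE => /andP[C0 _].
by case/predU1P=> [->|/mapP[ds _ ->]] //=; case: C C0.
Qed.

Lemma mergeable_lt_size bs : bs != [::] -> mergeable bs < size bs.
Proof.
elim: bs => // B [|C bs] IH _ //=; have := IH isT; rewrite /=; lia.
Qed.

(** An arbitrary predicate [a] lets the induction absorb the leading block: it shifts the size by
    one and the number of pairs by whether that block is mergeable with the next. *)
Lemma count_insertions (a : nat -> nat -> bool) n bs :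
  bs != [::] -> [::] \notin bs -> {in flatten bs, forall x, x < n} ->
  count (fun cs => a (size cs) (mergeable cs)) (insertions n bs) =
  mergeable bs * a (size bs) (mergeable bs).-1
  + (size bs - mergeable bs) * a (size bs) (mergeable bs)
  + a (size bs).+1 (mergeable bs).+1.
Proof.
elim: bs a => // B [|C bs] IH a _.
  rewrite inE eq_sym => B0 lt_n /=.
  have -> : last 0 B < n.
    apply: lt_n; rewrite /= cats0; case: B B0 => //= x B _; exact: mem_last.
  by rewrite mul0n subn0 mul1n !addn0.
rewrite inE negb_or => /andP[_ N] lt_n.
set D := C :: bs in IH N lt_n *.
have D0 : D != [::] by [].
have lt_n' : {in flatten D, forall x, x < n}.
  by move=> x xD; apply: lt_n; rewrite /= mem_cat xD orbT.
(* Appending [n] to [B] breaks the pair, as the next block starts below [n]. *)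
have fitsF : fits (rcons B n) D = false.
  rewrite /= last_rcons ltnNge ltnW //; apply: (head_lt (B := C) lt_n').
    by rewrite inE eqxx.
  by apply: contraNneq N => <-; rewrite inE eqxx.
clearbody D; rewrite /= count_map fitsF add0n; set c := fits B D.
rewrite (eq_in_count (a2 := fun cs => a (size cs).+1 (c + mergeable cs))); last first.
  by move=> cs cD /=; rewrite (insertions_fits _ D0 N cD).
rewrite (IH (fun j t => a j.+1 (c + t))) //.
move: (mergeable_lt_size D0) c; move: (mergeable D) (size D) => t j lt_tj c.
case: c => /=; rewrite ?add0n; last by rewrite subSn 1?ltnW //; lia.
case: t lt_tj => [|t] lt_tj; rewrite ?add1n ?add0n /= ?mul0n ?subSS ?subn0; lia.
Qed.

(** The index starts at [n.+2] because a first block inserted into the empty list gains no mergeable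
    pair. The factor [0 < k] guards [k.-1]: adding a block never leaves zero blocks. *)
Lemma block_countS n k t :
  block_count n.+2 k t =
  t.+1 * block_count n.+1 k t.+1 + (k - t) * block_count n.+1 k t
  + (if t is t'.+1 then block_count n.+1 k.-1 t' else 0) * (0 < k).
Proof.
have countE k' t' : block_count n.+1 k' t' =
    \sum_(bs <- block_lists n.+1) ((size bs == k') && (mergeable bs == t')).
  by rewrite /block_count -sum1_count big_mkcond.
rewrite {1}/block_count.
rewrite -[block_lists n.+2]/(flatten (map (insertions n.+1) (block_lists n.+1))).
rewrite count_flatten -map_comp sumnE big_map.
rewrite (eq_big_seq (fun bs =>
   t.+1 * ((size bs == k) && (mergeable bs == t.+1))
   + (k - t) * ((size bs == k) && (mergeable bs == t))
   + (if t is t'.+1 then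
        ((size bs == k.-1) && (mergeable bs == t')) : nat else 0) * (0 < k))).
  rewrite !big_split -!big_distrr -!big_distrl; congr (_ + _ + _).
  - by rewrite countE.
  - by rewrite countE.
  - by case: t => [|t]; [rewrite big1|rewrite countE].
move=> bs; rewrite mem_block_lists => rb /=.
have b0 : bs != [::].
  by apply: contraTneq rb => ->; rewrite /representation /=.
rewrite (count_insertions (fun j s => (j == k) && (s == t)) b0
  (representation_nil_notin rb) (representation_lt rb)).
have := mergeable_lt_size b0.
move: (size bs) (mergeable bs) => j s lt_sj.
by case: t => [|t]; lia.
Qed.

Lemma block_count_le n k t : k <= t -> block_count n.+1 k t = 0.
Proof.
move=> le_kt; apply/eqP; rewrite -leqn0 leqNgt -has_count.
apply/hasPn => bs; rewrite mem_block_lists => rb.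
have /mergeable_lt_size : bs != [::].
  by apply: contraTneq rb => ->; rewrite /representation /=.
by rewrite /=; lia.
Qed.

Lemma block_count0 n k :
  block_count n.+2 k 0 = block_count n.+1 k 1 + k * block_count n.+1 k 0.
Proof. by rewrite block_countS mul1n subn0 mul0n addn0. Qed.

(** Strong induction on [n] through [block_countS]. The term for a new block supplies one summand of
    Pascal's rule; the other two terms must give the other summand, which is expanded by
    [block_count0]. *)
Lemma block_count_mergeable n k t :
  block_count n.+1 (k + t) t = 'C(n, t) * block_count (n.+1 - t) k 0.
Proof.
elim/ltn_ind: n k t => -[|n] IH k [|t]; rewrite ?addn0 ?bin0 ?subn0 ?mul1n //.
  by rewrite bin0n /block_count /= addnS !andbF.
rewrite block_countS addnK addnS /= muln1.
have -> : block_count n.+1 (k + t) t = 'C(n, t) * block_count (n.+1 - t) k 0.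
  exact: IH.
rewrite subSS binS mulnDl; congr addn.
have -> : block_count n.+1 (k + t).+1 t.+1 = 'C(n, t.+1) * block_count (n - t) k 0.
  by rewrite -addnS IH.
(* For [n <= t] all binomials left in the goal vanish. *)
case: (leqP n t) => [le_nt|lt_tn].
  rewrite bin_small // !mul0n muln0 addn0.
  case: k => [|k]; first by rewrite block_count_le ?muln0 ?add0n.
  have -> : (k.+1 + t).+1 = k + t.+2 by lia.
  by rewrite IH // bin_small ?mul0n ?muln0 // ltnS ltnW.
have [m em] : exists m, n = m + t.+1 by exists (n - t.+1); rewrite subnK.
have -> : n.+1 - t = m.+2 by lia.
have -> : n - t = m.+1 by lia.
rewrite block_count0 mulnDr [X in _ + X = _]mulnCA; congr addn.
case: k => [|k]; first by rewrite !block_count_le ?muln0.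
have -> : (k.+1 + t).+1 = k + t.+2 by lia.
have -> : k.+1 = k + 1 by lia.
(* The hypothesis is used for [t.+2] pairs and, at the smaller index [m], for one pair; the latter
   requires strong induction. *)
rewrite !IH //; last by lia.
have -> : n.+1 - t.+2 = m by lia.
(* What remains is the absorption identity [t.+2 * 'C(n, t.+2) = (n - t.+1) * 'C(n, t.+1)]. *)
rewrite bin1 subn1 mulnA mul_bin_left.
have -> : n - t.+1 = m by lia.
by rewrite [m * _]mulnC mulnA.
Qed.

Lemma block_count_rec n k :
  block_count n.+2 k.+1 0 =
  k.+1 * block_count n.+1 k.+1 0 + n * block_count n k 0.
Proof.
have := block_count_mergeable n k 1; rewrite addn1 bin1 subn1 /= => e.
by rewrite block_count0 e addnC.
Qed.

(** * Run decomposition of a word, computed from the right *)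

Fixpoint runs (s : seq nat) : seq (seq nat) :=
  if s is x :: s' then
    if fits [:: x] (runs s') then (x :: head [::] (runs s')) :: behead (runs s')
    else [:: x] :: runs s'
  else [::].

Lemma flatten_runs s : flatten (runs s) = s.
Proof.
elim: s => //= x s IH; rewrite -[in RHS]IH.
by case: (runs s) => //= C bs; case: ifP.
Qed.

Lemma increasing_blocks_runs s : increasing_blocks (runs s).
Proof.
rewrite /increasing_blocks; elim: s => //= x s.
case: (runs s) => [|[|y C] bs] //=; rewrite ?andbT //=.
by case: ifP => //= ->.
Qed.

Lemma mergeable_runs s : mergeable (runs s) = 0.
Proof.
elim: s => //= x s; move: (increasing_blocks_runs s).
case: (runs s) => [|[|y C] bs] //= _; rewrite ?andbT //=.
by case: ifP => /= [_|->].
Qed.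

Lemma runs_cat B s : B != [::] -> sorted ltn B ->
  runs (B ++ s) =
  if fits B (runs s) then (B ++ head [::] (runs s)) :: behead (runs s)
  else B :: runs s.
Proof.
elim: B => // x [|y B] IH _ //= /andP[lt_xy pB].
move: (IH isT pB) => /= ->; case: (runs s) => [|C bs] /=; rewrite ?lt_xy //.
by case: (last y B < head 0 C); rewrite /= lt_xy.
Qed.

(** Without mergeable pairs no run crosses a block boundary. With [flatten_runs] and
    [mergeable_runs] this makes [runs] and [flatten] mutually inverse. *)
Lemma runs_flatten bs :
  increasing_blocks bs -> mergeable bs = 0 -> runs (flatten bs) = bs.
Proof.
elim: bs => //= B bs IH /andP[/andP[B0 sB] ib] m.
rewrite runs_cat // IH //; last by lia.
by case: (fits B bs) m.
Qed.

(** Each run of the concatenation is a union of consecutive blocks, so it starts where some block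
    starts. *)
Lemma heads_runs_flatten bs :
  increasing_blocks bs -> subseq (heads (runs (flatten bs))) (heads bs).
Proof.
elim: bs => //= B bs IH /andP[/andP[B0 sB] /IH sub].
rewrite runs_cat //; case: ifP => _ /=; last by rewrite eqxx.
case: (B) B0 => // x B' _ /=; rewrite eqxx -behead_map.
by apply: subseq_trans sub; case: (heads _) => //= y s; apply: subseq_cons.
Qed.

Definition run_end (s : seq nat) (i : nat) : bool :=
  (size s <= i.+1) || (nth 0 s i.+1 <= nth 0 s i).

(** Each run is counted at its last position, which links [runs] to the positional definition of
    runs. *)
Lemma size_runs s : size (runs s) = count (run_end s) (iota 0 (size s)).
Proof.
elim: s => //= x s IH.
(* Positions in the tail are shifted by one, leaving position 0 as the only new one. *)
rewrite -[1]addn0 iotaDl count_map.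
rewrite (eq_count (a2 := run_end s)) -?IH; last by [].
move: (increasing_blocks_runs s) (flatten_runs s); rewrite /run_end /=.
case: (runs s) => [|[|y C] bs] //= _ e; first by rewrite -e.
by rewrite -e /= ltnNge; case: (y <= x).
Qed.

Lemma subseq_heads_flatten bs :
  increasing_blocks bs -> subseq (heads bs) (flatten bs).
Proof.
elim: bs => //= -[|x B] bs IH //= /andP[_ /IH sub]; rewrite eqxx.
exact: subseq_trans sub (suffix_subseq _ _).
Qed.

Lemma uniq_flatten_block (T : eqType) (bs : seq (seq T)) B C x :
  uniq (flatten bs) -> B \in bs -> C \in bs -> x \in B -> x \in C -> B = C.
Proof.
elim: bs => //= D bs IH; rewrite cat_uniq => /and3P[_ /hasPn dis u].
have inF E : E \in bs -> x \in E -> x \notin D.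
  by move=> Ebs xE; apply: dis; apply/flattenP; exists E.
rewrite !inE => /predU1P[->|Bbs] /predU1P[->|Cbs] // xB xC.
- by move/negP: (inF _ Cbs xC).
- by move/negP: (inF _ Bbs xB).
- exact: IH.
Qed.

(** On all of [nat], [minn] has no neutral element, so [block_min] is handled as an iterated
    commutative semigroup operation. *)
HB.instance Definition _ := SemiGroup.isComLaw.Build nat minn minnA minnC.

(** * Permutations as words, and their runs as factors *)

Section Words.

Variable n : nat.
Implicit Types (p : 'S_n) (i j : 'I_n).

Definition word p : seq nat := map val (one_line p).

Lemma size_word p : size (word p) = n.
Proof. by rewrite 2!size_map size_enum_ord. Qed.

Lemma nth_word p i : nth 0 (word p) i = p i.
Proof.
rewrite (nth_map i) 1?size_map ?size_enum_ord //.
by rewrite (nth_map i) ?size_enum_ord // nth_ord_enum.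
Qed.

Lemma word_inj : injective word.
Proof.
move=> p q e; apply/permP => i; apply: val_inj.
by rewrite /= -!nth_word e.
Qed.

Lemma perm_word p : perm_eq (word p) (iota 0 n).
Proof.
rewrite /word /one_line -val_enum_ord; apply: perm_map.
apply: uniq_perm; rewrite ?enum_uniq ?(map_inj_uniq perm_inj) ?enum_uniq //.
move=> i; rewrite mem_enum; apply/mapP; exists ((p^-1)%g i).
  by rewrite mem_enum.
by rewrite permKV.
Qed.

Lemma word_surj s : perm_eq s (iota 0 n) -> exists p, word p = s.
Proof.
move=> ps; have sz : size s = n by rewrite (perm_size ps) size_iota.
have us : uniq s by rewrite (perm_uniq ps) iota_uniq.
have lt_s i : nth 0 s i < n.
  have : nth 0 s i \in s by rewrite mem_nth ?sz.
  by rewrite (perm_mem ps) mem_iota.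
pose f i := Ordinal (lt_s i).
have f_inj : injective f.
  move=> i j /(congr1 val) /= /eqP; rewrite nth_uniq ?sz // => /eqP.
  exact: val_inj.
exists (perm f_inj); apply: (@eq_from_nth _ 0); rewrite size_word ?sz // => i lt_i.
by rewrite (nth_word _ (Ordinal lt_i)) permE.
Qed.

Lemma increasing_factorP p i j :
  reflect (i <= j /\ forall a b : 'I_n, i <= a -> a < b -> b <= j -> p a < p b)
          (increasing_factor p i j).
Proof.
apply: (iffP andP) => [[le_ij /forallP inc]|[le_ij inc]]; split=> //.
  move=> a b ia ab bj; move/forallP: (inc a) => /(_ b); rewrite ia ab bj; exact.
apply/forallP => a; apply/forallP => b; apply/implyP => /and3P[]; exact: inc.
Qed.

Lemma is_runP p i j :
  reflect (increasing_factor p i j /\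
           forall i' j', i' <= i -> j <= j' -> increasing_factor p i' j' ->
             i' = i /\ j' = j)
          (is_run p i j).
Proof.
apply: (iffP andP) => [[inc /forallP mx]|[inc mx]]; split=> //.
  move=> i' j' ii jj inc'; move/forallP: (mx i') => /(_ j').
  by rewrite ii jj inc' /= => /andP[/eqP-> /eqP->].
apply/forallP => i'; apply/forallP => j'; apply/implyP => /and3P[ii jj inc'].
by case: (mx _ _ ii jj inc') => -> ->; rewrite !eqxx.
Qed.

Lemma increasing_factor_refl p i : increasing_factor p i i.
Proof. by apply/increasing_factorP; split=> // a b; lia. Qed.

Lemma run_endP p j :
  reflect (forall j' : 'I_n, j' = j.+1 :> nat -> p j' < p j) (run_end (word p) j).
Proof.
rewrite /run_end size_word; apply: (iffP orP) => [[le_nj|le_p] j' e|lt_p].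
- by have := ltn_ord j'; rewrite e ltnNge le_nj.
- rewrite -e !nth_word in le_p; rewrite ltn_neqAle le_p andbT.
  apply/negP => /eqP/val_inj/perm_inj ejj; move: e; rewrite ejj; lia.
- case: (leqP n j.+1) => [|lt_jn]; [by left|right].
  by rewrite ltnW // (nth_word p (Ordinal lt_jn)) nth_word lt_p.
Qed.

(** If the next letter were larger, the factor could be extended to the right, against
    maximality. *)
Lemma is_run_end p i j : is_run p i j -> run_end (word p) j.
Proof.
case/is_runP=> /increasing_factorP[le_ij inc] mx.
apply/run_endP => j' ej; rewrite ltnNge; apply/negP => le_p.
have lt_p : p j < p j'.
  rewrite ltn_neqAle le_p andbT.
  apply/negP => /eqP/val_inj/perm_inj ejj; move: ej; rewrite ejj; lia.
have inc' : increasing_factor p i j'.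
  apply/increasing_factorP; split=> [|a b ia ab bj]; first by lia.
  have [le_bj|lt_jb] := leqP b j; first exact: inc.
  have -> : b = j' by apply: val_inj => /=; lia.
  have [->|ne_aj] := eqVneq a j; first by [].
  apply: ltn_trans lt_p; apply: inc => //.
  have : (a : nat) != j by [].
  by lia.
have le_jj : j <= j' by lia.
by have [_ ejj] := mx _ _ (leqnn i) le_jj inc'; move: ej; rewrite ejj; lia.
Qed.

Lemma run_end_is_run p j : run_end (word p) j -> exists i, is_run p i j.
Proof.
(* The run starts at the least [i] from which the factor up to [j] increases; [j] itself is a
   candidate. *)
move/run_endP=> endj.
have [i inc mn] := @arg_minnP _ j (fun i => increasing_factor p i j) val
  (increasing_factor_refl p j).
exists i; apply/is_runP; split=> // i' j' ii jj inc'.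
have ejj : j' = j.
  apply: val_inj; apply/eqP; rewrite eqn_leq jj andbT leqNgt; apply/negP => lt_jj.
  have lt_jn : j.+1 < n by apply: leq_ltn_trans (ltn_ord j').
  have := endj (Ordinal lt_jn) erefl; rewrite ltnNge => /negP; apply; apply: ltnW.
  case/increasing_factorP: inc' => _; apply=> //=.
  by case/increasing_factorP: inc => le_ij _; apply: leq_trans le_ij.
split=> //; apply: val_inj; apply/eqP; rewrite eqn_leq ii mn //.
by rewrite -ejj.
Qed.

Lemma is_run_inj p i i' j : is_run p i j -> is_run p i' j -> i = i'.
Proof.
move=> /is_runP[inc mx] /is_runP[inc' mx'].
case: (leqP i i') => [le_ii|/ltnW le_ii].
  by case: (mx' _ _ le_ii (leqnn j) inc).
by case: (mx _ _ le_ii (leqnn j) inc').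
Qed.

(** A run is determined by its last position, so projecting to the second coordinate loses
    nothing. *)
Lemma num_runsE p : num_runs p = size (runs (word p)).
Proof.
rewrite size_runs size_word -val_enum_ord count_map -size_filter.
rewrite /num_runs -(card_in_imset (f := snd)); last first.
  move=> [i j] [i' j']; rewrite !inE /= => ri ri' ejj; rewrite -ejj in ri' *.
  by rewrite (is_run_inj ri ri').
rewrite cardE; apply: perm_size; apply: uniq_perm.
- exact: enum_uniq.
- by rewrite filter_uniq ?enum_uniq.
move=> j; rewrite mem_enum mem_filter mem_enum andbT /=.
apply/imsetP/idP => [[[i j'] /=]|/run_end_is_run[i rij]].
  by rewrite inE /= => /is_run_end endj ->.
by exists (i, j); rewrite ?inE.
Qed.

(** * Run-sortedness as increasing run minima *)

Lemma sorted_enum (B : {set 'I_n}) : sorted ltn (map val (enum B)).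
Proof.
have -> : enum B = [seq i <- enum 'I_n | i \in B].
  by rewrite {1}/enum_mem -enumT.
apply: (subseq_sorted ltn_trans (map_subseq val (filter_subseq _ _))).
by rewrite val_enum_ord iota_ltn_sorted.
Qed.

Lemma block_minE (B : {set 'I_n}) : B != set0 -> block_min B = head 0 (map val (enum B)).
Proof.
rewrite -card_gt0 cardE /block_min -big_enum /= => B0.
case: (enum B) B0 (sorted_enum B) => //= x s _; rewrite big_cons.
rewrite (path_sortedE ltn_trans) => /andP[/allP lt_x _].
apply/minn_idPl; rewrite big_seq; elim/big_ind: _ => [|a b xa xb|i si].
- exact: ltnW.
- by rewrite leq_min xa.
- by apply/ltnW/lt_x/map_f.
Qed.

(** The witnessing partition may have mergeable pairs, so its blocks need not be the runs; still,
    the run minima form a subsequence of the block minima. *)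
Lemma run_sorted_heads p : run_sorted p -> sorted ltn (heads (runs (word p))).
Proof.
case/existsP=> P /andP[/and3P[_ _ P0] /eqP e].
have memP B : B \in sorted_blocks P -> B != set0.
  by rewrite mem_sort mem_enum => BP; apply: contraNneq P0 => <-.
pose bs := map (map val) (block_representation P).
have ebs : flatten bs = word p by rewrite /word e map_flatten.
have ib : increasing_blocks bs.
  apply/allP => _ /mapP[_ /mapP[B /memP B0 ->] ->]; rewrite sorted_enum andbT.
  by rewrite -size_eq0 size_map -cardE cards_eq0.
rewrite -ebs; apply: (subseq_sorted ltn_trans (heads_runs_flatten ib)).
(* Sorting gives only weak increase; strictness comes from the minima being distinct letters. *)
rewrite ltn_sorted_uniq_leq; apply/andP; split.
  apply: (subseq_uniq (subseq_heads_flatten ib)).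
  by rewrite ebs (perm_uniq (perm_word p)) iota_uniq.
rewrite /bs /block_representation -2!map_comp.
rewrite (_ : map _ _ = map (@block_min n) (sorted_blocks P)); last first.
  by apply/eq_in_map => B /memP B0; rewrite block_minE.
by rewrite sorted_map; apply: sort_sorted => B C; apply: leq_total.
Qed.

(** The witness is the partition into the letter sets of the runs; the point is that sorting it by
    minima restores the order of the runs. *)
Lemma heads_run_sorted p : sorted ltn (heads (runs (word p))) -> run_sorted p.
Proof.
set rs := runs (word p) => sh.
have ers : flatten rs = word p by apply: flatten_runs.
have mem_word x : (x \in word p) = (x < n).
  by rewrite (perm_mem (perm_word p)) mem_iota.
have uw : uniq (flatten rs) by rewrite ers (perm_uniq (perm_word p)) iota_uniq.
have ib : increasing_blocks rs by apply: increasing_blocks_runs.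
pose block (B : seq nat) := [set x : 'I_n | val x \in B].
have enum_block B : B \in rs -> map val (enum (block B)) = B.
  move=> Brs; apply: (irr_sorted_eq ltn_trans ltnn).
  - exact: sorted_enum.
  - by case/andP: (allP ib _ Brs).
  move=> x; apply/mapP/idP => [[y]|xB]; first by rewrite mem_enum inE => yB ->.
  have lt_xn : x < n by rewrite -mem_word -ers; apply/flattenP; exists B.
  by exists (Ordinal lt_xn); rewrite ?mem_enum ?inE.
have block0 B : B \in rs -> block B != set0.
  move=> Brs; rewrite -cards_eq0 cardE -(size_map val) enum_block // size_eq0.
  by case/andP: (allP ib _ Brs).
have min_block B : B \in rs -> block_min (block B) = head 0 B.
  by move=> Brs; rewrite block_minE ?block0 // enum_block.
have min_blocks : map (@block_min n) (map block rs) = heads rs.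
  by rewrite -map_comp; apply/eq_in_map => B /min_block.
have /andP[uh _] : uniq (heads rs) && sorted leq (heads rs).
  by rewrite -ltn_sorted_uniq_leq.
pose P := [set C in map block rs].
have perm_blocks : perm_eq (map block rs) (sorted_blocks P).
  rewrite perm_sym perm_sort; apply: uniq_perm; first exact: enum_uniq.
    by apply: (map_uniq (f := @block_min n)); rewrite min_blocks.
  by move=> B; rewrite mem_enum inE.
(* Both lists have the same elements and strictly increasing minima, hence they coincide. *)
have eP : sorted_blocks P = map block rs.
  apply: (irr_sorted_eq (leT := relpre (@block_min n) ltn)).
  - by move=> B C D /=; apply: ltn_trans.
  - by move=> B /=; rewrite ltnn.
  - rewrite -sorted_map ltn_sorted_uniq_leq.
    rewrite -(perm_uniq (perm_map _ perm_blocks)) min_blocks uh sorted_map.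
    by apply: sort_sorted => B C; apply: leq_total.
  - by rewrite -sorted_map min_blocks.
  - by move=> B; rewrite (perm_mem perm_blocks).
apply/existsP; exists P; apply/andP; split.
  apply/and3P; split.
  - rewrite eqEsubset subsetT /=; apply/subsetP => x _.
    have : val x \in flatten rs by rewrite ers mem_word ltn_ord.
    case/flattenP=> B Brs xB; apply/bigcupP; exists (block B); last by rewrite inE.
    by rewrite inE map_f.
  - apply/trivIsetP => B C; rewrite !inE => /mapP[B' Brs ->] /mapP[C' Crs ->].
    apply: contraR => /pred0Pn[x /andP[/=]]; rewrite !inE => xB xC.
    by rewrite (uniq_flatten_block uw Brs Crs xB xC).
  - rewrite inE; apply/negP => /mapP[B Brs e].
    by move: (block0 _ Brs); rewrite -e eqxx.
apply/eqP/(inj_map val_inj); rewrite -/(word p) map_flatten -ers.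
rewrite /block_representation eP -2!map_comp; congr flatten.
by rewrite -[LHS]map_id; apply/eq_in_map => B /enum_block.
Qed.

End Words.

(** Both sides count the same words: [word] is injective on permutations, and [flatten] is injective
    on the block lists without mergeable pairs, being inverted by [runs]. *)
Lemma r_block_count n k : r n k = block_count n k 0.
Proof.
rewrite /r /block_count -size_filter cardE -(size_map (@word n)).
rewrite -(size_map flatten); set L := filter _ _.
have LP bs : reflect [/\ representation n bs, size bs = k & mergeable bs = 0]
                     (bs \in L).
  rewrite mem_filter mem_block_lists andbC; apply: (iffP and3P) => [[]|[]].
    by move=> -> /eqP-> /eqP->.
  by move=> -> -> ->.
have runsK bs : bs \in L -> runs (flatten bs) = bs.
  by case/LP=> /and3P[_ ib _] _ m0; apply: runs_flatten.
apply: perm_size; apply: uniq_perm.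
- by rewrite (map_inj_uniq (@word_inj n)) enum_uniq.
- rewrite map_inj_in_uniq ?filter_uniq ?block_lists_uniq // => bs cs bL cL e.
  by rewrite -(runsK bs) // e runsK.
move=> s; apply/mapP/mapP => [[p]|[bs bL ->]].
  rewrite mem_enum inE num_runsE => /andP[/run_sorted_heads sh /eqP sz] ->.
  exists (runs (word p)); last by rewrite flatten_runs.
  apply/LP; split=> //; last exact: mergeable_runs.
  by apply/and3P; rewrite flatten_runs perm_word; split=> //; apply: increasing_blocks_runs.
case/LP: (bL) => /and3P[/word_surj[p ep] ib sh] sz m0.
exists p => //; rewrite mem_enum inE num_runsE ep runsK // sz eqxx andbT.
by apply: heads_run_sorted; rewrite ep runsK.
Qed.

Theorem theorem20 :
  [/\ r 0 0 = 1, r 1 0 = 0, r 1 1 = 1 &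
      forall n k : nat, 2 <= n -> 1 <= k ->
        r n k = k * r (n - 1) k + (n - 2) * r (n - 2) (k - 1)].
Proof.
(* The initial values follow by evaluating the block lists; the bounds put the indices in the form
   [n.+2], [k.+1]. *)
split; rewrite ?r_block_count // => -[|[|n]] // [|k] // _ _.
by rewrite !r_block_count block_count_rec !subSS !subn0.
Qed.
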